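(* Assume that the weak Poincaré inequality $$\mu(f^2)\le\beta(r)\,\mathcal E(f,f)+r\|f\|_\infty^2,\qquad r>0,\ f\in\mathcal D(\mathcal E),\ \mu(f)=0,$$ holds for some decreasing function $\beta:(0,\infty)\to(0,\infty)$. If for every $\varepsilon>0$ $$\inf_{n,k\ge1}e^{\tilde Z_n(V)}\beta\big(\varepsilon e^{-\tilde Z_n(V)}\big)\big(\tilde\eta_{n,k}+\tilde\gamma_k+\mu(\rho>n-k)\big)=0,$$ then $$\mu_V(f^2)\le\beta_V(r)\,\mathcal E_V(f,f)+r\|f\|_\infty^2,\qquad r>0,\ f\in\mathcal D(\mathcal E_V),\ \mu_V(f)=0,$$ holds with $$\beta_V(r):=\inf\Big\{2\beta\Big(\frac r8e^{-\tilde Z_n(V)}\Big)e^{\tilde K_{n,k}(V)}:\ n,k\ge1,\ 6\mu_V(\rho>n)+2e^{\tilde Z_n(V)}\beta\Big(\frac r8e^{-\tilde Z_n(V)}\Big)\big(4\tilde\eta_{n,k}+\tilde\gamma_k+4\lambda\mu(\rho>n-k)\big)\le\frac r2\Big\},$$ and $\beta_V(r)<\infty$ for all $r>0$.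
   Context: Setting: $(E,d)$ is a Polish space with Borel $\sigma$-field and a probability measure $\mu$. Let $q:E\times E\to[0,\infty)$ be measurable with $q(x,x)=0$ for all $x$, and $\lambda:=\sup_{x\in E}\int_E(1\wedge d(x,y)^2)q(x,y)\,\mu(\mathrm dy)<\infty.$ For bounded measurable $f,g$ set $\Gamma(f,g)(x)=\int_E(f(x)-f(y))(g(x)-g(y))q(x,y)\mu(\mathrm dy)$; $\mathcal A$ is the set of bounded measurable $f$ with $\Gamma(f,f)$ bounded, assumed dense in $L^2(\mu)$. $(\mathcal E,\mathcal D(\mathcal E))$ is the closure in $L^2(\mu)$ of $\mathcal E(f,g)=\mu(\Gamma(f,g))$ on $\mathcal A$. Fix $o\in E$, $\rho(x)=d(o,x)$. $V$ is a measurable function bounded on each set $\{\rho\le r\}$, $r>0$, with $\mu(e^V)=1$; $\mu_V(\mathrm dx)=e^{V(x)}\mu(\mathrm dx)$, and $(\mathcal E_V,\mathcal D(\mathcal E_V))$ is the closure in $L^2(\mu_V)$ of $\mathcal E_V(f,g)=\mu_V(\Gamma(f,g))$ on $\mathcal A$. $\|f\|_\infty$ is the uniform norm. Notation (for $n,k\ge1$): $\tilde K_{n,k}(V)=\sup_{\rho\le n}V-\inf_{\rho\le n+k+1}V$; $\tilde Z_n(V)=\sup_{\rho\le n}V$; $\tilde\eta_{n,k}=\iint_{\{\rho(x)>n+k+1,\ \rho(y)\le n+1\}}q(x,y)\mu(\mathrm dy)\mu(\mathrm dx)$; $\tilde\gamma_k=\iint_{\{d(x,y)>k\}}q(x,y)\mu(\mathrm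 dy)\mu(\mathrm dx)$. *)

(* Defs.v *)
From HB Require Import structures.
From mathcomp Require Import all_boot all_order all_algebra.
From mathcomp Require Import all_classical all_reals all_analysis.
Set Implicit Arguments. Unset Strict Implicit. Unset Printing Implicit Defensive.
Import Order.TTheory GRing.Theory Num.Theory.
Local Open Scope classical_set_scope.
Local Open Scope ring_scope.

Section Defs.
Context {dT : measure_display} {T : measurableType dT} {R : realType}.

Definition is_metric (d : T -> T -> R) : Prop :=
  (forall x y, d x y = 0 <-> x = y) /\ (forall x y, d x y = d y x) /\
  (forall x y z, d x z <= d x y + d y z).

Definition is_polish (d : T -> T -> R) : Prop :=
  is_metric d /\
  (exists D : set T, countable D /\
     forall x eps, 0 < eps -> exists2 y, D y & d x y < eps) /\
  (forall u : nat -> T,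
     (forall eps, 0 < eps -> exists N, forall m n, (N <= m)%N -> (N <= n)%N ->
        d (u m) (u n) < eps) ->
     exists x, forall eps, 0 < eps -> exists N, forall n, (N <= n)%N -> d (u n) x < eps).

Definition d_open (d : T -> T -> R) (U : set T) : Prop :=
  forall x, U x -> exists2 r, 0 < r & [set y | d x y < r] `<=` U.

Definition is_borel (d : T -> T -> R) : Prop :=
  (@measurable _ T) = <<s d_open d >>.

Local Open Scope ereal_scope.

Definition Gam (mu : {measure set T -> \bar R}) (q : T -> T -> R) (f : T -> R) (x : T)
  : \bar R := \int[mu]_y (((f x - f y) ^+ 2 * q x y)%R%:E).

Definition Eform (mu : {measure set T -> \bar R}) q (f : T -> R) : \bar R :=
  \int[mu]_x Gam mu q f x.

(* E_V(f,f) = mu_V(Gamma(f,f)), mu_V(dx) = e^{V x} mu(dx) *)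
Definition EformV (mu : {measure set T -> \bar R}) q (V : T -> R) (f : T -> R) : \bar R :=
  \int[mu]_x ((expR (V x))%:E * Gam mu q f x).

Definition Aset (mu : {measure set T -> \bar R}) q (f : T -> R) : Prop :=
  measurable_fun setT f /\ (exists M : R, forall x, (`|f x| <= M)%R) /\
  (exists C : R, forall x, Gam mu q f x <= C%:E).

Definition L2sq (mu : {measure set T -> \bar R}) (g : T -> R) : \bar R :=
  \int[mu]_x ((g x ^+ 2)%R%:E).
Definition L2sqV (mu : {measure set T -> \bar R}) (V : T -> R) (g : T -> R) : \bar R :=
  \int[mu]_x ((expR (V x) * g x ^+ 2)%R%:E).

(* [closure_val A l2 form f e]: f belongs to the domain of the closure (in the
   L^2 space whose squared norm is l2) of the form [form] defined on A, and the
   closed form takes value e at f. *)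
Definition closure_val (A : set (T -> R)) (l2 : (T -> R) -> \bar R)
  (form : (T -> R) -> \bar R) (f : T -> R) (e : R) : Prop :=
  measurable_fun setT f /\ l2 f < +oo /\
  exists fn : nat -> T -> R,
    (forall n, A (fn n)) /\
    (forall eps : R, (0 < eps)%R -> exists N, forall n, (N <= n)%N ->
        l2 (fun x => fn n x - f x)%R < eps%:E) /\
    (forall eps : R, (0 < eps)%R -> exists N, forall n m, (N <= n)%N -> (N <= m)%N ->
        form (fun x => fn n x - fn m x)%R < eps%:E) /\
    (forall eps : R, (0 < eps)%R -> exists N, forall n, (N <= n)%N ->
        (e - eps)%R%:E < form (fn n) /\ form (fn n) < (e + eps)%R%:E).

Definition unorm (f : T -> R) : \bar R := ereal_sup [set `|f x|%:E | x in setT].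

Definition Zt (rho : T -> R) (V : T -> R) (n : nat) : R :=
  sup [set V x | x in [set x | rho x <= n%:R]%R].
Definition Kt (rho : T -> R) (V : T -> R) (n k : nat) : R :=
  (Zt rho V n - inf [set V x | x in [set x | rho x <= n%:R + k%:R + 1]%R])%R.
Definition etat (mu : {measure set T -> \bar R}) q (rho : T -> R) (n k : nat) : \bar R :=
  \int[mu]_(x in [set x | n%:R + k%:R + 1 < rho x]%R)
     \int[mu]_(y in [set y | rho y <= n%:R + 1]%R) (q x y)%:E.
Definition gammat (mu : {measure set T -> \bar R}) q (d : T -> T -> R) (k : nat) : \bar R :=
  \int[mu]_x \int[mu]_(y in [set y | k%:R < d x y]%R) (q x y)%:E.
Definition lambdaq (mu : {measure set T -> \bar R}) q (d : T -> T -> R) : \bar R :=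
  ereal_sup [set (\int[mu]_y ((Num.min 1 (d x y ^+ 2) * q x y)%R%:E)) | x in setT].

Definition betaV (mu : {measure set T -> \bar R}) q (d : T -> T -> R) (rho : T -> R)
  (V : T -> R) (beta : R -> R) (r : R) : \bar R :=
  ereal_inf [set (2 * beta (r / 8 * expR (- Zt rho V nk.1)) * expR (Kt rho V nk.1 nk.2))%R%:E
    | nk in [set nk : nat * nat | (1 <= nk.1)%N /\ (1 <= nk.2)%N /\
       6%:E * (\int[mu]_(x in [set x | nk.1%:R < rho x]%R) (expR (V x))%:E)
       + (2 * expR (Zt rho V nk.1) * beta (r / 8 * expR (- Zt rho V nk.1)))%R%:E
         * (4%:E * etat mu q rho nk.1 nk.2 + gammat mu q d nk.2
            + 4%:E * lambdaq mu q d * mu [set x | nk.1%:R - nk.2%:R < rho x]%R)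
       <= (r / 2)%R%:E]].

End Defs.

(* Main.v *)
Require Import Defs.
From HB Require Import structures.
From mathcomp Require Import all_boot all_order all_algebra.
From mathcomp Require Import all_classical all_reals all_analysis.
From mathcomp Require Import measurable_realfun ring lra.
Import Order.TTheory GRing.Theory Num.Theory.
Local Open Scope classical_set_scope.
Local Open Scope ring_scope.

(* Put [rho = d(o,.)], let [f] in [A] be bounded by [M] and let [l] be the
   1-Lipschitz cutoff equal to 1 on [rho <= n] and to 0 on [rho >= n + 1].
   Splitting [(f l)(x) - (f l)(y)] according to the positions of [x] and [y] gives
     E(f l) <= 2 e^(-inf_{rho <= n+k+1} V) E_V(f)
               + M^2 (eta_{n,k} + 2 gamma_k + 2 lambda mu(rho > n - k)).
   With [c = mu(f l)], the quantity [mu_V((f - c)^2)] is at most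
   [e^(Z_n) mu((f l - c)^2) + 4 M^2 mu_V(rho > n)], and the weak Poincare inequality
   for [mu] applies to [f l - c]. If [f] is only in the domain of the closure and
   [||f|| = M], approximate it by elements of [A], truncated at level [M]. *)

(** The constant [c] is centred for mu, while the claim is centred for mu_V. This costs nothing: if
    mu_V(f) = 0 then mu_V(f^2) <= mu_V((f - c)^2) for every [c], and only |c| <= M matters for the
    tail. The bound on A is therefore stated with an unspecified [c], which also suits the
    approximants, whose mu_V-mean need not vanish. V may be unbounded, and the cutoff confines its
    use to balls: an upper bound on rho <= n turns mu_V into mu at the price e^(Z_n), and a lower
    bound on rho <= n + k + 1 turns the energy back at the price e^(-inf V). The product of the two
    is e^(K_{n,k}); the 2 beside it is the constant of the product rule for (f l)(x) - (f l)(y). The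
    price of the cutoff is jumps: eta counts those from the region where V is uncontrolled, gamma
    the long ones, and lambda mu(rho > n - k) the short ones that can feel the slope of [l]. The
    constraint on (n, k) keeps these and the mu_V-tail below (r/2) M^2; the other half of r M^2 is
    the oscillation term. *)

Section measurable_sets.
Context {d : measure_display} {T : measurableType d} {R : realType}.
Implicit Types (f : T -> R) (a : R).

Lemma measurable_set_gt f a : measurable_fun setT f ->
  measurable [set x | a < f x].
Proof.
move=> mf; rewrite (_ : [set x | _] = setT `&` f @^-1` `]a, +oo[).
  by apply: mf => //; exact: measurable_itv.
by rewrite setTI; apply/seteqP; split => x /=; rewrite in_itv /= andbT.
Qed.

Lemma measurable_set_le f a : measurable_fun setT f ->
  measurable [set x | f x <= a].
Proof.
move=> mf; rewrite (_ : [set x | _] = setT `&` f @^-1` `]-oo, a]).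
  by apply: mf => //; exact: measurable_itv.
by rewrite setTI; apply/seteqP; split => x /=; rewrite in_itv.
Qed.

End measurable_sets.

(** * Integrals of nonnegative real-valued functions *)

Section real_integrals.
Context {d : measure_display} {T : measurableType d} {R : realType}.
Context (m : {measure set T -> \bar R}).
Implicit Types (f g : T -> R) (A : set T).
Local Open Scope ereal_scope.

Lemma ge0_le_integral_EFin f g : measurable_fun setT f -> measurable_fun setT g ->
  (forall x, 0 <= f x)%R -> (forall x, f x <= g x)%R ->
  \int[m]_x (f x)%:E <= \int[m]_x (g x)%:E.
Proof.
move=> mf mg f0 fg; apply: ge0_le_integral => //.
- by move=> x _; rewrite lee_fin.
- exact/measurable_EFinP.
- exact/measurable_EFinP.
- by move=> x _; rewrite lee_fin.
Qed.

Lemma ge0_integralD_EFin f g : measurable_fun setT f -> measurable_fun setT g ->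
  (forall x, 0 <= f x)%R -> (forall x, 0 <= g x)%R ->
  \int[m]_x (f x + g x)%:E = \int[m]_x (f x)%:E + \int[m]_x (g x)%:E.
Proof.
move=> mf mg f0 g0; under eq_integral do rewrite EFinD.
apply: ge0_integralD => //; try exact/measurable_EFinP.
- by move=> x _; rewrite lee_fin.
- by move=> x _; rewrite lee_fin.
Qed.

Lemma ge0_integralZ_EFin c f : measurable_fun setT f ->
  (forall x, 0 <= f x)%R -> (0 <= c)%R ->
  \int[m]_x (c * f x)%:E = c%:E * \int[m]_x (f x)%:E.
Proof.
move=> mf f0 c0; under eq_integral do rewrite EFinM.
apply: ge0_integralZl_EFin => //; first by move=> x _; rewrite lee_fin.
exact/measurable_EFinP.
Qed.

Lemma integral_mkcond_EFin A f :
  \int[m]_(x in A) (f x)%:E = \int[m]_x (\1_A x * f x)%:E.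
Proof.
rewrite integral_mkcond; apply: eq_integral => x _.
by rewrite patchE indicE; case: ifPn => _; rewrite ?mul1r ?mul0r.
Qed.

Lemma ge0_integral_EFin f : (forall x, 0 <= f x)%R -> 0 <= \int[m]_x (f x)%:E.
Proof. by move=> f0; apply: integral_ge0 => x _; rewrite lee_fin. Qed.

End real_integrals.

(** * Joint measurability of the metric *)

Section metric_measurability.
Context {dT : measure_display} {T : measurableType dT} {R : realType}.
Context (d : T -> T -> R).

Lemma metric_ge0 x y : is_metric d -> 0 <= d x y.
Proof.
move=> [d0 [dC dtri]].
have dxx : d x x = 0 by apply/d0.
by have := dtri x y x; rewrite dxx (dC y x); lra.
Qed.

Lemma measurable_metric_ball c r : is_metric d -> is_borel d ->
  measurable [set x | d c x < r].
Proof.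
move=> [d0 [dC dtri]] bd; rewrite bd; apply: sub_sigma_algebra => x /= dcx.
exists (r - d c x); first lra.
by move=> y /= dxy; have := dtri c x y; lra.
Qed.

(* Separability puts the Borel sets of the product metric inside the product
   sigma-algebra: [d x y < r] iff [d c x < s] and [d c y < r - s] for some [c]
   in a countable dense set and some rational [s]. *)
Lemma measurable_fun_metric : is_polish d -> is_borel d ->
  measurable_fun setT (fun z : T * T => d z.1 z.2).
Proof.
move=> [md [[D [cD denseD] _]]] bd; have [d0 [dC dtri]] := md.
move=> _; apply: (measurability _ (RGenInftyO.measurableE R)) => //.
move=> _ [_ [r ->] <-]; rewrite setTI.
(* A countable set is empty or the image of a sequence; an empty dense set leaves no point in [T],
   so the preimage is empty as well. *)
have /pfcard_geP[D0|[e]] := cD.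
  rewrite (_ : _ @^-1` _ = set0) //.
  apply/seteqP; split => // -[x y] _.
  by have [c] := denseD x 1 ltr01; rewrite D0.
rewrite (_ : _ @^-1` _ = \bigcup_(n : nat) \bigcup_(s : rat)
    ([set x | d (e n) x < ratr s] `*` [set y | d (e n) y < r - ratr s])).
  apply: bigcup_measurable => n _; apply: bigcupT_measurable_rat => s.
  by apply: measurableX; exact: measurable_metric_ball.
apply/seteqP; split => -[x y] /=; rewrite in_itv /=.
  (* Half of the gap: with d c x < s < (r - d x y) / 2 the triangle inequality gives d c y < r -
     s. *)
  move=> dxy; have r0 : 0 < (r - d x y) / 2 by lra.
  have [c /(@surj _ _ _ _ e)[n _ <-] dxc] := denseD x _ r0.
  have [s] := rat_in_itvoo dxc; rewrite in_itv /= => /andP[s1 s2].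
  exists n => //; exists s => //; split => /=; first by rewrite dC.
  by have := dtri (e n) x y; rewrite (dC (e n) x); lra.
move=> [n _ [s _ [/= d1 d2]]].
by have := dtri x (e n) y; rewrite (dC x (e n)); lra.
Qed.

End metric_measurability.

(** Serves twice: as the profile of the cutoff in rho and as the truncation of approximants at level
    M. Both uses rest on its being 1-Lipschitz. *)
Definition clamp {R : realType} (a b t : R) : R := Num.max a (Num.min b t).

(** * Truncation on the line and the cutoff profile *)

Section clamp.
Context {R : realType}.
Implicit Types a b s t : R.

Lemma clamp_ge a b t : a <= clamp a b t.
Proof. by rewrite /clamp le_max lexx. Qed.

Lemma clamp_le a b t : a <= b -> clamp a b t <= b.
Proof. by move=> ab; rewrite /clamp ge_max ab ge_min lexx. Qed.

Lemma clamp_id a b t : a <= t -> t <= b -> clamp a b t = t.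
Proof. by move=> at_ tb; rewrite /clamp (min_idPr tb) (max_idPr at_). Qed.

Lemma clamp_lip a b s t : `|clamp a b s - clamp a b t| <= `|s - t|.
Proof.
have lip_max x y : `|Num.max a x - Num.max a y| <= `|x - y|.
  have := ler_norm (x - y); have := ler_norm (y - x); rewrite (distrC y).
  rewrite /Num.max; case: (ltP a x) => ?; case: (ltP a y) => ? ? ?;
  by rewrite ler_norml; apply/andP; split; lra.
have lip_min x y : `|Num.min b x - Num.min b y| <= `|x - y|.
  have := ler_norm (x - y); have := ler_norm (y - x); rewrite (distrC y).
  rewrite /Num.min; case: (ltP b x) => ?; case: (ltP b y) => ? ? ?;
  by rewrite ler_norml; apply/andP; split; lra.
exact: le_trans (lip_max _ _) (lip_min _ _).
Qed.

Lemma measurable_clamp {d : measure_display} {T : measurableType d} a b (f : T -> R) :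
  measurable_fun setT f -> measurable_fun setT (fun x => clamp a b (f x)).
Proof. by move=> mf; apply: measurable_maxr => //; exact: measurable_minr. Qed.

Lemma norm_clamp b t : 0 <= b -> `|clamp (- b) b t| <= b.
Proof. by move=> b0; rewrite ler_norml clamp_ge clamp_le//; lra. Qed.

Definition cutoff (n t : R) : R := clamp 0 1 (n + 1 - t).

Lemma cutoff_ge0 n t : 0 <= cutoff n t.
Proof. exact: clamp_ge. Qed.

Lemma cutoff_le1 n t : cutoff n t <= 1.
Proof. exact: clamp_le. Qed.

Lemma cutoff_eq1 n t : t <= n -> cutoff n t = 1.
Proof.
move=> tn; apply/eqP; rewrite eq_le cutoff_le1 /cutoff /clamp le_max le_min lexx /=.
by apply/orP; right; lra.
Qed.

Lemma cutoff_eq0 n t : n + 1 <= t -> cutoff n t = 0.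
Proof.
move=> nt; rewrite /cutoff /clamp; apply/max_idPl.
by rewrite ge_min; apply/orP; right; lra.
Qed.

Lemma cutoff_lip n t s : `|cutoff n t - cutoff n s| <= `|t - s|.
Proof.
have := clamp_lip 0 1 (n + 1 - t) (n + 1 - s).
by rewrite (_ : n + 1 - t - (n + 1 - s) = s - t) ?(distrC s)//; ring.
Qed.

End clamp.

(** * The forms E and E_V and the class A *)

Section forms.
Context {dT : measure_display} {T : measurableType dT} {R : realType}.
Context (mu : probability T R) (q : T -> T -> R).
Hypothesis mq : measurable_fun setT (fun z : T * T => q z.1 z.2).
Hypothesis q_ge0 : forall x y, 0 <= q x y.
Implicit Types f g V : T -> R.
Local Open Scope ereal_scope.

Lemma measurable_fun_section {d' : measure_display} {U : measurableType d'}
    (F : T * T -> U) x :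
  measurable_fun setT F -> measurable_fun setT (fun y => F (x, y)).
Proof. by move=> mF; exact: measurableT_comp mF (pair1_measurable x). Qed.

Lemma iterated_integral (F : T * T -> R) : measurable_fun setT F ->
  (forall z, 0 <= F z)%R ->
  \int[mu]_x \int[mu]_y (F (x, y))%:E = \int[mu \x mu]_z (F z)%:E.
Proof.
move=> mF F0; rewrite (fubini_tonelli1 (m1 := mu) (m2 := mu)) //.
exact/measurable_EFinP.
Qed.

Lemma measurable_sqdiff f : measurable_fun setT f ->
  measurable_fun setT (fun z : T * T => (f z.1 - f z.2) ^+ 2 * q z.1 z.2)%R.
Proof.
move=> mf; apply: measurable_funM => //; apply: measurable_funX.
by apply: measurable_funB; apply: measurableT_comp.
Qed.

Lemma sqdiff_ge0 f x y : (0 <= (f x - f y) ^+ 2 * q x y)%R.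
Proof. by rewrite mulr_ge0 ?sqr_ge0. Qed.

Lemma Gam_ge0 f x : 0 <= Gam mu q f x.
Proof. by apply: ge0_integral_EFin => y; exact: sqdiff_ge0. Qed.

Lemma measurable_Gam f : measurable_fun setT f -> measurable_fun setT (Gam mu q f).
Proof.
move=> mf.
apply: (measurable_fun_fubini_tonelli_F (m2 := mu)
  (fun z : T * T => ((f z.1 - f z.2) ^+ 2 * q z.1 z.2)%:E)).
  by apply/measurable_EFinP; exact: measurable_sqdiff.
by move=> z; rewrite lee_fin sqdiff_ge0.
Qed.

Lemma le_Gam f g x : measurable_fun setT f -> measurable_fun setT g ->
  (forall y, (g x - g y) ^+ 2 <= (f x - f y) ^+ 2)%R ->
  Gam mu q g x <= Gam mu q f x.
Proof.
move=> mf mg gf; apply: ge0_le_integral_EFin.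
- exact: (measurable_fun_section _ x (measurable_sqdiff g mg)).
- exact: (measurable_fun_section _ x (measurable_sqdiff f mf)).
- by move=> y; exact: sqdiff_ge0.
- by move=> y; exact: ler_wpM2r.
Qed.

Lemma Gam_shift f c x : Gam mu q (fun y => f y - c)%R x = Gam mu q f x.
Proof. by apply: eq_integral => y _; congr (_ ^+ 2 * _)%:E; ring. Qed.

(** By Tonelli the energies become integrals over [mu \x mu], so that energy bounds reduce to
    pointwise inequalities in (x, y). *)
Lemma EformVE V f : measurable_fun setT V -> measurable_fun setT f ->
  EformV mu q V f =
  \int[mu \x mu]_z (expR (V z.1) * ((f z.1 - f z.2) ^+ 2 * q z.1 z.2))%:E.
Proof.
move=> mV mf; rewrite -iterated_integral /=.
- apply: eq_integral => x _; rewrite -ge0_integralZ_EFin ?expR_ge0 //.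
    exact: (measurable_fun_section _ x (measurable_sqdiff f mf)).
  by move=> y; exact: sqdiff_ge0.
- apply: measurable_funM; last exact: measurable_sqdiff.
  by apply: measurableT_comp => //; apply: measurableT_comp.
- by move=> z; rewrite mulr_ge0 ?expR_ge0 ?sqdiff_ge0.
Qed.

Lemma EformE f : measurable_fun setT f ->
  Eform mu q f = \int[mu \x mu]_z ((f z.1 - f z.2) ^+ 2 * q z.1 z.2)%:E.
Proof.
move=> mf; rewrite -iterated_integral //; first exact: measurable_sqdiff.
by move=> z; exact: sqdiff_ge0.
Qed.

Lemma Eform_ge0 f : 0 <= Eform mu q f.
Proof. by apply: integral_ge0 => x _; exact: Gam_ge0. Qed.

Lemma EformV_ge0 V f : 0 <= EformV mu q V f.
Proof.
by apply: integral_ge0 => x _; rewrite mule_ge0 ?Gam_ge0// lee_fin expR_ge0.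
Qed.

Lemma le_EformV V f g : measurable_fun setT V ->
  measurable_fun setT f -> measurable_fun setT g ->
  (forall x, Gam mu q g x <= Gam mu q f x) ->
  EformV mu q V g <= EformV mu q V f.
Proof.
move=> mV mf mg gf.
have mE h : measurable_fun setT h ->
    measurable_fun setT (fun x => (expR (V x))%:E * Gam mu q h x).
  move=> mh; apply: emeasurable_funM; last exact: measurable_Gam.
  by apply/measurable_EFinP; exact: measurableT_comp.
apply: ge0_le_integral => //; [|exact: mE|exact: mE|].
- by move=> x _; rewrite mule_ge0 ?Gam_ge0// lee_fin expR_ge0.
- by move=> x _; rewrite lee_wpmul2l// lee_fin expR_ge0.
Qed.

Lemma Aset_shift f c : Aset mu q f -> Aset mu q (fun x => f x - c)%R.
Proof.
move=> [mf [[M fM] [C fC]]]; split; first exact: measurable_funB.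
split; last by exists C => x; rewrite Gam_shift.
by exists (M + `|c|)%R => x; rewrite (le_trans (ler_normB _ _))// lerD2r.
Qed.

Lemma Eform_lty f : Aset mu q f -> Eform mu q f < +oo.
Proof.
move=> [mf [_ [C fC]]]; apply: (@le_lt_trans _ _ (\int[mu]_x (cst C%:E x))).
  apply: ge0_le_integral => //.
  - by move=> x _; exact: Gam_ge0.
  - exact: measurable_Gam.
by rewrite integral_cst// [X in _ * X]probability_setT mule1 ltry.
Qed.

(** The Markov property: a contraction shrinks every increment f(x) - f(y). It lets approximants be
    truncated without raising their energy. *)
Lemma Gam_clamp a b f x : measurable_fun setT f ->
  Gam mu q (fun y => clamp a b (f y)) x <= Gam mu q f x.
Proof.
move=> mf; apply: le_Gam => //; first exact: measurable_clamp.
move=> y; rewrite -(real_normK (num_real _)) -[leRHS](real_normK (num_real _)).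
by rewrite lerXn2r ?nnegrE// clamp_lip.
Qed.

Lemma Aset_clamp M f : (0 <= M)%R -> Aset mu q f ->
  Aset mu q (fun x => clamp (- M) M (f x)).
Proof.
move=> M0 [mf [_ [C fC]]]; split; first exact: measurable_clamp.
split; first by exists M => x; exact: norm_clamp.
by exists C => x; rewrite (le_trans (Gam_clamp _ _ _ _ mf)).
Qed.

End forms.

(** Product rule for squared increments, applied with [a], [b] values of f and [s], [t] values of
    the cutoff. The splitting (a - b) t + a (s - t) asks for a bound on only one value of each. *)
Lemma sqr_mulB_le {R : realFieldType} (M a b s t : R) : `|a| <= M -> 0 <= t <= 1 ->
  (a * s - b * t) ^+ 2 <= 2 * (a - b) ^+ 2 + 2 * M ^+ 2 * (s - t) ^+ 2.
Proof.
move=> aM /andP[t0 t1].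
have -> : a * s - b * t = (a - b) * t + a * (s - t) by ring.
set u := (a - b) * t; set v := a * (s - t).
have uv : (u + v) ^+ 2 <= 2 * u ^+ 2 + 2 * v ^+ 2.
  by have := sqr_ge0 (u - v); rewrite sqrrB sqrrD; lra.
have u2 : u ^+ 2 <= (a - b) ^+ 2.
  by rewrite exprMn ler_piMr ?sqr_ge0// expr_le1.
have v2 : v ^+ 2 <= M ^+ 2 * (s - t) ^+ 2.
  rewrite exprMn ler_wpM2r ?sqr_ge0// -(real_normK (num_real a)).
  by rewrite lerXn2r// nnegrE (le_trans (normr_ge0 a)).
lra.
Qed.

Lemma indic_ge0 {R : numDomainType} {T : Type} (A : set T) x : 0 <= (\1_A x : R).
Proof. by rewrite indicE ler0n. Qed.

Lemma min1_sqr_ge0 {R : realDomainType} (x : R) : 0 <= Num.min 1 (x ^+ 2).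
Proof. by rewrite le_min ler01 sqr_ge0. Qed.

Ltac nneg := by repeat first [done | exact: sqr_ge0 | exact: expR_ge0
  | exact: indic_ge0 | exact: min1_sqr_ge0 | apply: mulr_ge0 | apply: addr_ge0].

Lemma indic_in {T : Type} {R : pzRingType} (A : set T) x : A x -> \1_A x = 1 :> R.
Proof. by move=> Ax; rewrite indicE mem_set. Qed.

(** * Energy of a function multiplied by the cutoff *)

Section cutoff_energy.
Context {dT : measure_display} {T : measurableType dT} {R : realType}.
Context (mu : probability T R) (q : T -> T -> R) (d : T -> T -> R) (o : T).
Hypothesis md : is_metric d.
Hypothesis mq : measurable_fun setT (fun z : T * T => q z.1 z.2).
Hypothesis q_ge0 : forall x y, 0 <= q x y.
Hypothesis mdist : measurable_fun setT (fun z : T * T => d z.1 z.2).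
Implicit Types f V : T -> R.

(** Brings the increments of the cutoff under the weight that defines lambda: they are at most 1,
    and at most d(x, y) since rho is 1-Lipschitz. *)
Lemma cutoff_sqdist_le N x y :
  (cutoff N (d o x) - cutoff N (d o y)) ^+ 2 <= Num.min 1 (d x y ^+ 2).
Proof.
have [_ [dC dtri]] := md.
set s := cutoff _ _; set t := cutoff _ _.
have st1 : `|s - t| <= 1.
  have := cutoff_ge0 N (d o x); have := cutoff_ge0 N (d o y).
  have := cutoff_le1 N (d o x); have := cutoff_le1 N (d o y).
  by rewrite -/s -/t => ? ? ? ?; rewrite ler_norml; apply/andP; split; lra.
have std : `|s - t| <= d x y.
  apply: le_trans (cutoff_lip _ _ _) _.
  have := dtri o x y; have := dtri o y x; rewrite (dC y x) => ? ?.
  by rewrite ler_norml; apply/andP; split; lra.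
rewrite le_min -(real_normK (num_real (s - t))) expr_le1// st1 /=.
by rewrite lerXn2r// nnegrE metric_ge0.
Qed.

(** If rho(x) > N + K + 1, only the value at y survives, and only for rho(y) <= N + 1. Otherwise
    V(x) is controlled and the product rule applies. Its cutoff increment is charged to the long
    jumps if d(x, y) > K, else to the set rho(x) > N - K. *)
Lemma cutoff_sqdiff_le f V M C N K x y : 0 <= K -> 0 <= C ->
  (forall x, `|f x| <= M) ->
  (forall x, d o x <= N + K + 1 -> 1 <= C * expR (V x)) ->
  (f x * cutoff N (d o x) - f y * cutoff N (d o y)) ^+ 2 <=
  M ^+ 2 * (\1_[set x | N + K + 1 < d o x] x * \1_[set y | d o y <= N + 1] y) +
  2 * C * (expR (V x) * (f x - f y) ^+ 2) +
  2 * M ^+ 2 * \1_[set z | K < d z.1 z.2] (x, y) +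
  2 * M ^+ 2 * (\1_[set x | N - K < d o x] x * Num.min 1 (d x y ^+ 2)).
Proof.
move=> K0 C0 fM CV; have [_ [_ dtri]] := md.
have M2 : 0 <= M ^+ 2 by rewrite sqr_ge0.
have M22 : 0 <= 2 * M ^+ 2 by nneg.
have B0 : 0 <= 2 * C * (expR (V x) * (f x - f y) ^+ 2).
  nneg.
have C0' : 0 <= 2 * M ^+ 2 * \1_[set z : T * T | K < d z.1 z.2] (x, y).
  nneg.
have D0 : 0 <= 2 * M ^+ 2 *
    (\1_[set x | N - K < d o x] x * Num.min 1 (d x y ^+ 2)) by nneg.
have [far|near] := ltP (N + K + 1) (d o x).
  rewrite (cutoff_eq0 N (d o x)); last lra.
  rewrite mulr0 sub0r sqrrN (indic_in [set x | N + K + 1 < d o x])// mul1r.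
  have [yN|yN] := leP (d o y) (N + 1); last first.
    rewrite (cutoff_eq0 N (d o y)); last lra.
    rewrite mulr0 expr0n /=; nneg.
  rewrite (indic_in [set y | d o y <= N + 1])// mulr1.
  rewrite (_ : (f y * cutoff N (d o y)) ^+ 2 = `|f y| ^+ 2 * cutoff N (d o y) ^+ 2);
    last by rewrite exprMn real_normK ?num_real.
  have : `|f y| ^+ 2 * cutoff N (d o y) ^+ 2 <= M ^+ 2; last lra.
  apply: le_trans (_ : `|f y| ^+ 2 <= _).
    by rewrite ler_piMr ?sqr_ge0// expr_le1 ?cutoff_ge0 ?cutoff_le1.
  by rewrite lerXn2r// nnegrE (le_trans (normr_ge0 (f y))).
have ly : 0 <= cutoff N (d o y) <= 1 by rewrite cutoff_ge0 cutoff_le1.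
have := sqr_mulB_le M (f x) (f y) (cutoff N (d o x)) _ (fM x) ly.
set S := _ ^+ 2; set D := (f x - f y) ^+ 2 => SD.
have lip := cutoff_sqdist_le N x y.
have SV : D <= C * (expR (V x) * D).
  by rewrite mulrA ler_peMl ?sqr_ge0// CV.
have A0 : 0 <= M ^+ 2 * (\1_[set x | N + K + 1 < d o x] x *
                         \1_[set y | d o y <= N + 1] y) by nneg.
have [kd|dk] := ltP K (d x y).
  suff : 2 * M ^+ 2 * (cutoff N (d o x) - cutoff N (d o y)) ^+ 2 <=
    2 * M ^+ 2 * \1_[set z : T * T | K < d z.1 z.2] (x, y) by lra.
  rewrite ler_wpM2l//.
  rewrite (indic_in [set z : T * T | K < d z.1 z.2])//.
  by apply: le_trans lip _; rewrite ge_min lexx.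
have [NKx|xNK] := ltP (N - K) (d o x).
  suff : 2 * M ^+ 2 * (cutoff N (d o x) - cutoff N (d o y)) ^+ 2 <=
    2 * M ^+ 2 * (\1_[set x | N - K < d o x] x * Num.min 1 (d x y ^+ 2)) by lra.
  rewrite ler_wpM2l//.
  by rewrite (indic_in [set x | N - K < d o x])// mul1r.
(* Here rho(x) <= N - K and d(x, y) <= K, so both points lie in rho <= N, where the cutoff is
   constant. *)
have : cutoff N (d o x) - cutoff N (d o y) = 0.
  by rewrite !cutoff_eq1 ?subrr//; have := dtri o x y; lra.
by move=> l0; move: SD; rewrite l0 expr0n /= mulr0; lra.
Qed.

Local Open Scope ereal_scope.

Lemma measurable_fun_dist x : measurable_fun setT (d x).
Proof. exact: (measurable_fun_section _ x mdist). Qed.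

Lemma measurable_min_dist :
  measurable_fun setT (fun z : T * T => Num.min 1 (d z.1 z.2 ^+ 2) * q z.1 z.2)%R.
Proof.
apply: measurable_funM => //; apply: measurable_minr => //.
exact: measurable_funX.
Qed.

Lemma lambdaq_ub x :
  \int[mu]_y (Num.min 1 (d x y ^+ 2) * q x y)%:E <= lambdaq mu q d.
Proof. by apply: ereal_sup_ubound; exists x. Qed.

Lemma lambdaq_ge0 : 0 <= lambdaq mu q d.
Proof.
apply: le_trans (lambdaq_ub o); apply: ge0_integral_EFin => y.
nneg.
Qed.

Lemma etat_prod (n k : nat) :
  etat mu q (d o) n k = \int[mu \x mu]_z
    (\1_[set x | n%:R + k%:R + 1 < d o x]%R z.1 *
     \1_[set y | d o y <= n%:R + 1]%R z.2 * q z.1 z.2)%:E.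
Proof.
rewrite -iterated_integral /=; last 2 first.
- apply: measurable_funM => //; apply: measurable_funM.
    apply: measurableT_comp => //; apply: measurable_indic.
    by apply: measurable_set_gt; exact: measurable_fun_dist.
  apply: measurableT_comp => //; apply: measurable_indic.
  by apply: measurable_set_le; exact: measurable_fun_dist.
- move=> z; nneg.
rewrite /etat integral_mkcond; apply: eq_integral => x _.
rewrite patchE !indicE; case: ifPn => _.
  by rewrite integral_mkcond_EFin; apply: eq_integral => y _; rewrite mul1r.
by rewrite integral0_eq// => y _; rewrite !mul0r.
Qed.

Lemma gammat_prod (k : nat) :
  gammat mu q d k = \int[mu \x mu]_z
    (\1_[set z : T * T | k%:R < d z.1 z.2]%R z * q z.1 z.2)%:E.
Proof.
rewrite -iterated_integral /=; last 2 first.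
- apply: measurable_funM => //; apply: measurable_indic.
  exact: measurable_set_gt.
- move=> z; nneg.
apply: eq_integral => x _; rewrite integral_mkcond_EFin.
by apply: eq_integral => y _; rewrite !indicE; congr (_%:R * _)%:E; rewrite !mem_setE.
Qed.

(** For fixed x the inner integral is at most lambda, which is a supremum over x; what remains is
    the mass of the set. *)
Lemma min_dist_integral_le (a : R) :
  \int[mu \x mu]_z (\1_[set x | a < d o x]%R z.1 *
     (Num.min 1 (d z.1 z.2 ^+ 2) * q z.1 z.2))%:E <=
  lambdaq mu q d * mu [set x | a < d o x]%R.
Proof.
have mA : measurable [set x | (a < d o x)%R].
  by apply: measurable_set_gt; exact: measurable_fun_dist.
have mind0 x y : (0 <= Num.min 1 (d x y ^+ 2) * q x y)%R.
  nneg.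
rewrite -iterated_integral /=; last 2 first.
- apply: measurable_funM; last exact: measurable_min_dist.
  by apply: measurableT_comp => //; exact: measurable_indic.
- move=> z; nneg.
rewrite -[X in mu X]setIT -(integral_indic mu measurableT mA).
rewrite -ge0_integralZl//; last 2 first.
- by apply/measurable_EFinP; exact: measurable_indic.
- exact: lambdaq_ge0.
apply: ge0_le_integral => //.
- move=> x _; apply: ge0_integral_EFin => y; nneg.
- apply: (measurable_fun_fubini_tonelli_F (m2 := mu) (fun z : T * T =>
    (\1_[set x | a < d o x]%R z.1 * (Num.min 1 (d z.1 z.2 ^+ 2) * q z.1 z.2))%:E)).
    apply/measurable_EFinP; apply: measurable_funM; last exact: measurable_min_dist.
    by apply: measurableT_comp => //; exact: measurable_indic.
  move=> z; rewrite lee_fin; nneg.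
- apply: emeasurable_funM => //.
  by apply/measurable_EFinP; exact: measurable_indic.
move=> x _; rewrite ge0_integralZ_EFin//; last first.
  exact: (measurable_fun_section _ x measurable_min_dist).
by rewrite muleC lee_wpmul2r// ?lee_fin ?indicE ?ler0n// lambdaq_ub.
Qed.

Lemma cutoff_energy_le f V M C (n k : nat) : (0 <= C)%R ->
  measurable_fun setT f -> measurable_fun setT V ->
  (forall x, `|f x| <= M)%R ->
  (forall x, d o x <= n%:R + k%:R + 1 -> 1 <= C * expR (V x))%R ->
  Eform mu q (fun x => f x * cutoff n%:R (d o x))%R <=
  (M ^+ 2)%:E * etat mu q (d o) n k + (2 * C)%:E * EformV mu q V f +
  (2 * M ^+ 2)%:E * gammat mu q d k +
  (2 * M ^+ 2)%:E * (lambdaq mu q d * mu [set x | (n%:R - k%:R < d o x)%R]).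
Proof.
move=> C0 mf mV fM CV.
have mdo := measurable_fun_dist o.
have M2 : (0 <= 2 * M ^+ 2)%R by rewrite mulr_ge0// sqr_ge0.
have mg : measurable_fun setT (fun x => f x * cutoff n%:R (d o x))%R.
  apply: measurable_funM => //; apply: measurable_clamp.
  by apply: measurable_funB.
have mi1 (a : R) : measurable_fun setT
    (fun z : T * T => \1_[set x | a < d o x]%R z.1 : R).
  by apply: measurableT_comp => //; apply: measurable_indic; exact: measurable_set_gt.
have mi2 : measurable_fun setT
    (fun z : T * T => \1_[set y | d o y <= n%:R + 1]%R z.2 : R).
  by apply: measurableT_comp => //; apply: measurable_indic; exact: measurable_set_le.
have m1 : measurable_fun setT (fun z : T * T =>
    \1_[set x | n%:R + k%:R + 1 < d o x]%R z.1 *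
    \1_[set y | d o y <= n%:R + 1]%R z.2 * q z.1 z.2)%R.
  by apply: measurable_funM => //; exact: measurable_funM.
have m2 : measurable_fun setT (fun z : T * T =>
    expR (V z.1) * ((f z.1 - f z.2) ^+ 2 * q z.1 z.2))%R.
  apply: measurable_funM; last exact: measurable_sqdiff.
  by apply: measurableT_comp => //; exact: measurableT_comp.
have m3 : measurable_fun setT (fun z : T * T =>
    \1_[set z : T * T | k%:R < d z.1 z.2]%R z * q z.1 z.2)%R.
  by apply: measurable_funM => //; apply: measurable_indic; exact: measurable_set_gt.
have m4 : measurable_fun setT (fun z : T * T =>
    \1_[set x | n%:R - k%:R < d o x]%R z.1 *
    (Num.min 1 (d z.1 z.2 ^+ 2) * q z.1 z.2))%R.
  by apply: measurable_funM => //; exact: measurable_min_dist.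
have p1 z : (0 <= \1_[set x | n%:R + k%:R + 1 < d o x]%R z.1 *
    \1_[set y | d o y <= n%:R + 1]%R z.2 * q z.1 z.2)%R by nneg.
have p2 z : (0 <= expR (V z.1) * ((f z.1 - f z.2) ^+ 2 * q z.1 z.2))%R.
  nneg.
have p3 z : (0 <= \1_[set z : T * T | k%:R < d z.1 z.2]%R z * q z.1 z.2)%R.
  nneg.
have p4 z : (0 <= \1_[set x | n%:R - k%:R < d o x]%R z.1 *
    (Num.min 1 (d z.1 z.2 ^+ 2) * q z.1 z.2))%R.
  nneg.
(* The last term is lowered to the integral that it dominates. All four terms are then integrals
   over [mu \x mu], and the pointwise bound multiplied by q finishes. *)
apply: le_trans (leeD (lexx _) (lee_wpmul2l _ (min_dist_integral_le _))); last first.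
  by rewrite lee_fin.
rewrite EformE// EformVE// etat_prod gammat_prod.
have cM c (F : T * T -> R) : measurable_fun setT F ->
    measurable_fun setT (fun z => c * F z)%R by move=> mF; exact: measurable_funM.
rewrite -!ge0_integralZ_EFin//; try nneg.
rewrite -ge0_integralD_EFin//; [|exact: cM|exact: cM| | ]; last 2 first.
- move=> z; nneg.
- move=> z; nneg.
rewrite -ge0_integralD_EFin//; [|by apply: measurable_funD; exact: cM|exact: cM| | ];
  last 2 first.
- move=> z; nneg.
- move=> z; nneg.
rewrite -ge0_integralD_EFin//; [|by repeat apply: measurable_funD; exact: cM|
  exact: cM| | ]; last 2 first.
- move=> z; nneg.
- move=> z; nneg.
apply: ge0_le_integral_EFin.
- exact: (measurable_sqdiff q mq _ mg).
- by repeat apply: measurable_funD; exact: cM.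
- move=> z; nneg.
move=> [x y] /=; have K0 : (0 <= k%:R :> R)%R by [].
have := cutoff_sqdiff_le f V M C n%:R k%:R x y K0 C0 fM CV.
move=> /(ler_wpM2r (q_ge0 x y)) /le_trans; apply.
by rewrite !mulrDl !mulrA.
Qed.

(** The product rule bounds Gamma(f l, f l) by 2 Gamma(f, f) + 2 M^2 lambda, uniformly in x;
    finiteness of lambda makes this a real bound. *)
Lemma Aset_cutoff f N : lambdaq mu q d < +oo -> Aset mu q f ->
  Aset mu q (fun x => f x * cutoff N (d o x))%R.
Proof.
move=> lfin [mf [[M fM] [C fC]]].
have ml : measurable_fun setT (fun x => cutoff N (d o x)).
  by apply: measurable_clamp; apply: measurable_funB => //; exact: measurable_fun_dist.
have M0 : (0 <= M)%R by apply: le_trans (normr_ge0 _) (fM o).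
have lE : (fine (lambdaq mu q d))%:E = lambdaq mu q d.
  by rewrite fineK// ge0_fin_numE// lambdaq_ge0.
have mg : measurable_fun setT (fun x => f x * cutoff N (d o x))%R.
  exact: measurable_funM.
split => //; split.
  exists M => x; rewrite normrM (ger0_norm (cutoff_ge0 _ _)).
  by rewrite (le_trans (ler_piMr _ (cutoff_le1 _ _))).
exists (2 * C + 2 * M ^+ 2 * fine (lambdaq mu q d))%R => x.
have ms := measurable_fun_section _ x (measurable_sqdiff q mq f mf).
have md2 := measurable_fun_section _ x measurable_min_dist.
have md0 y : (0 <= Num.min 1 (d x y ^+ 2) * q x y)%R.
  nneg.
apply: (@le_trans _ _ (2%:E * Gam mu q f x + (2 * M ^+ 2)%:E *
   \int[mu]_y (Num.min 1 (d x y ^+ 2) * q x y)%:E)); last first.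
  rewrite [leRHS]EFinD; apply: leeD; first by rewrite [leRHS]EFinM lee_wpmul2l.
  rewrite [leRHS]EFinM lE.
  by rewrite lee_wpmul2l ?lambdaq_ub// lee_fin; nneg.
rewrite /Gam -ge0_integralZ_EFin//; last by move=> y; nneg.
rewrite -ge0_integralZ_EFin ?mulr_ge0 ?sqr_ge0//.
rewrite -ge0_integralD_EFin; last 4 first.
- by apply: measurable_funM.
- by apply: measurable_funM.
- move=> y; nneg.
- move=> y; nneg.
apply: ge0_le_integral_EFin.
- exact: (measurable_fun_section _ x (measurable_sqdiff q mq _ mg)).
- by apply: measurable_funD; exact: measurable_funM.
- move=> y; nneg.
move=> y; rewrite !(mulrA _ _ (q x y)) -mulrDl ler_wpM2r//.
have ly : (0 <= cutoff N (d o y) <= 1)%R by rewrite cutoff_ge0 cutoff_le1.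
apply: le_trans (sqr_mulB_le M _ _ _ _ (fM x) ly) _.
by rewrite lerD2l ler_wpM2l ?cutoff_sqdist_le//; nneg.
Qed.

End cutoff_energy.

Ltac enneg := by repeat first [done | by rewrite lee_fin | apply: mule_ge0
  | apply: adde_ge0].

(** * From extended-real bounds to real ones, and limits of error terms *)

Section ereal_bounds.
Context {R : realType}.
Implicit Types (x y : \bar R) (r c : R).
Local Open Scope ereal_scope.

Lemma ge0_le_EFin x r : 0 <= x -> x <= r%:E -> exists2 s : R, (0 <= s)%R & x = s%:E.
Proof. by case: x => // s; rewrite lee_fin => s0 _; exists s. Qed.

Lemma ge0_addl_le x y r : 0 <= y -> x + y <= r%:E -> x <= r%:E.
Proof. by move=> y0; apply: le_trans; rewrite leeDl. Qed.

Lemma ge0_addr_le x y r : 0 <= x -> x + y <= r%:E -> y <= r%:E.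
Proof. by move=> x0; apply: le_trans; rewrite leeDr. Qed.

Lemma pmul_le_EFin c x r : (0 < c)%R -> c%:E * x <= r%:E -> x <= (c^-1 * r)%:E.
Proof. by move=> c0; rewrite EFinM lee_pdivlMl. Qed.

End ereal_bounds.

(** Test with e / (K + 1), where the added 1 covers K = 0. *)
Lemma ler_addgt0M {R : realFieldType} (x y K : R) : 0 <= K ->
  (forall e : R, 0 < e -> x <= y + K * e) -> x <= y.
Proof.
move=> K0 xyK; apply/ler_addgt0Pr => e e0.
apply: le_trans (xyK (e / (K + 1)) _) _; first by rewrite divr_gt0//; lra.
rewrite lerD2l mulrA ler_pdivrMr; last lra.
by rewrite mulrDr mulr1 mulrC lerDl ltW.
Qed.

Lemma exists_lower_bound {R : realFieldType} (P : nat -> Prop) (c : nat -> R) N :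
  (forall n, P n -> 0 < c n) ->
  exists2 b : R, 0 < b & forall n, (n < N)%N -> P n -> b <= c n.
Proof.
move=> c0; elim: N => [|N [b b0 bc]]; first by exists 1.
have [PN|nPN] := pselect (P N).
  exists (Num.min b (c N)); first by rewrite lt_min b0 c0.
  move=> n; rewrite ltnS leq_eqVlt => /orP[/eqP -> _|nN Pn].
    by rewrite ge_min lexx orbT.
  by rewrite ge_min bc.
exists b => // n; rewrite ltnS leq_eqVlt => /orP[/eqP -> //|]; exact: bc.
Qed.

(** * Integrals against an integrable density *)

Section weighted_integrals.
Context {dT : measure_display} {T : measurableType dT} {R : realType}.
Context (mu : probability T R).
Implicit Types (f g w : T -> R) (M : R).
Local Open Scope ereal_scope.

Lemma integrableM_bounded w f M : measurable_fun setT f -> (forall x, `|f x| <= M)%R ->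
  mu.-integrable setT (EFin \o w) ->
  mu.-integrable setT (EFin \o (fun x => w x * f x)%R).
Proof.
move=> mf fM iw; have mw : measurable_fun setT w.
  by apply/measurable_EFinP; exact: measurable_int iw.
apply: (le_integrable measurableT _ _ (integrableZl measurableT M iw)) => //.
  by apply/measurable_EFinP; exact: measurable_funM.
move=> x _ /=; rewrite lee_fin !normrM mulrC ler_wpM2r//.
by rewrite (le_trans (fM x))// ler_norm.
Qed.

Lemma integrable_cst1 : mu.-integrable setT (EFin \o cst 1%R).
Proof. exact: finite_measure_integrable_cst. Qed.

Lemma bounded_integrable f M : measurable_fun setT f -> (forall x, `|f x| <= M)%R ->
  mu.-integrable setT (EFin \o f).
Proof.
move=> mf fM; have := integrableM_bounded _ _ _ mf fM integrable_cst1.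
by apply: eq_integrable => // x _ /=; rewrite mul1r.
Qed.

(* The mean minimises the quadratic deviation. *)
Lemma le_sqr_deviation w f M c : (forall x, 0 <= w x)%R ->
  mu.-integrable setT (EFin \o w) -> measurable_fun setT f ->
  (forall x, `|f x| <= M)%R -> \int[mu]_x (w x * f x)%:E = 0 ->
  \int[mu]_x (w x * f x ^+ 2)%:E <= \int[mu]_x (w x * (f x - c) ^+ 2)%:E.
Proof.
move=> w0 iw mf fM wf0.
have iwf := integrableM_bounded _ _ _ mf fM iw.
have ih g K : measurable_fun setT g -> (forall x, `|g x| <= K)%R ->
    mu.-integrable setT (EFin \o (fun x => w x * g x ^+ 2)%R).
  move=> mg gK; apply: (integrableM_bounded w (fun x => g x ^+ 2)%R (K ^+ 2)%R) => //.
    exact: measurable_funX.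
  move=> x; rewrite normrX lerXn2r// nnegrE.
  exact: le_trans (gK x).
have iwc : mu.-integrable setT (EFin \o (fun x => w x * (f x - c) ^+ 2)%R).
  apply: (ih (fun x => f x - c)%R (M + `|c|)%R); first exact: measurable_funB.
  by move=> x; rewrite (le_trans (ler_normB _ _))// lerD2r.
have iwf2 : mu.-integrable setT (EFin \o (fun x => 2 * c * (w x * f x))%R).
  exact: (integrableZl measurableT (2 * c)%R iwf).
(* The added term 2 c w f has integral zero, and with it the integrand becomes w f^2 + w c^2. *)
apply: (@le_trans _ _ (\int[mu]_x ((EFin \o (fun x => w x * (f x - c) ^+ 2)%R) \+
    (EFin \o (fun x => 2 * c * (w x * f x))%R)) x)); last first.
  rewrite integralD_EFin//= [X in _ + X](_ : _ = 0) ?adde0//.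
  under eq_integral do rewrite EFinM.
  by rewrite integralZl// wf0 mule0.
apply: le_integral => //; first exact: (ih _ M).
  exact: integrableD.
move=> x _ /=; rewrite -EFinD lee_fin.
have := mulr_ge0 (w0 x) (sqr_ge0 c); set u := w x; set v := f x => ?.
by rewrite (_ : u * (v - c) ^+ 2 + 2 * c * (u * v) = u * v ^+ 2 + u * c ^+ 2)%R
  ?lerDl//; ring.
Qed.

(** The integrals over h <= n increase to the total integral, which is finite, so the complementary
    ones tend to 0. *)
Lemma integral_tail_lt w (h : T -> R) (e : R) : (forall x, 0 <= w x)%R ->
  mu.-integrable setT (EFin \o w) -> measurable_fun setT h -> (0 < e)%R ->
  exists N : nat, \int[mu]_(x in [set x | N%:R < h x]%R) (w x)%:E < e%:E.
Proof.
move=> w0 iw mh e0.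
have mw : measurable_fun setT (fun x => (w x)%:E) by exact: measurable_int iw.
have [I II] : exists I, \int[mu]_x (w x)%:E = I%:E.
  exists (fine (\int[mu]_x (w x)%:E)); rewrite fineK//.
  exact: (integrable_fin_num measurableT iw).
pose F (n : nat) := [set x | (h x <= n%:R)%R].
have mF n : measurable (F n) by exact: measurable_set_le.
have mG n : measurable [set x | (n%:R < h x)%R] by exact: measurable_set_gt.
have FG (n : nat) : \int[mu]_(x in F n) (w x)%:E +
    \int[mu]_(x in [set x | n%:R < h x]%R) (w x)%:E = I%:E.
  rewrite -ge0_integral_setU//.
  - rewrite -II; congr integral; apply/seteqP; split => // x _ /=.
    by case: (leP (h x) n%:R) => ?; [left|right].
  - exact: measurable_funTS.
  - by move=> x _; rewrite lee_fin.
  - rewrite disj_set2E; apply/eqP/seteqP; split => // x [/=].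
    by rewrite /F /= leNgt => /negP.
have : \int[mu]_(x in F n) (w x)%:E @[n --> \oo] --> I%:E.
  rewrite -II (_ : [set: T] = \bigcup_n F n).
    apply: ge0_nondecreasing_set_cvg_integral => //.
    - move=> n m nm; apply/subsetPset => x /= /le_trans; apply.
      by rewrite ler_nat.
    - by move=> n; exact: measurable_funTS.
    - by move=> n x _; rewrite lee_fin.
  apply/seteqP; split => // x _.
  exists (Num.bound `|h x|) => //=; apply: le_trans (ler_norm _) _.
  by apply/ltW; exact: archi_boundP.
move=> /fine_cvgP[[N1 _ finF]] /cvgrPdist_lt /(_ e e0)[N2 _ cvgF].
exists (maxn N1 N2).
have := finF (maxn N1 N2) (leq_maxl _ _); have := cvgF (maxn N1 N2) (leq_maxr _ _).
have := FG (maxn N1 N2).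
set a := integral _ _ _; set b := integral _ _ _ => ab /= Ia fa.
move: ab Ia; rewrite -(fineK fa) /=; case: b => //= b [ab].
by rewrite -ab (addrC (fine a)) addrK lte_fin => /(le_lt_trans (ler_norm _)).
Qed.

End weighted_integrals.

(** * The weak Poincare inequality for uncentred elements of A *)

Section centered_weak_poincare.
Context {dT : measure_display} {T : measurableType dT} {R : realType}.
Context (mu : probability T R) (q : T -> T -> R) (o : T) (beta : R -> R).
Hypothesis mq : measurable_fun setT (fun z : T * T => q z.1 z.2).
Hypothesis q_ge0 : forall x y, 0 <= q x y.
Hypothesis weak_poincare : forall (r : R) (f : T -> R) (e : R), 0 < r ->
  closure_val (Aset mu q) (L2sq mu) (Eform mu q) f e ->
  (\int[mu]_x (f x)%:E = 0)%E ->
  (L2sq mu f <= (beta r * e)%:E + r%:E * (unorm f * unorm f))%E.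
Implicit Types (f V : T -> R) (M : R).
Local Open Scope ereal_scope.

Lemma L2sq_lty f M : measurable_fun setT f -> (forall x, `|f x| <= M)%R ->
  L2sq mu f < +oo.
Proof.
move=> mf fM; have : L2sq mu f \is a fin_num.
  apply: integrable_fin_num => //.
  apply: (bounded_integrable mu (fun x => f x ^+ 2)%R (M ^+ 2)%R); first exact: measurable_funX.
  by move=> x; rewrite normrX lerXn2r// nnegrE; apply: le_trans (fM x).
by rewrite fin_numElt => /andP[].
Qed.

(** The assumed inequality speaks of the closure; a constant sequence places the elements of A in
    its domain. *)
Lemma closure_val_Aset f (e : R) : Aset mu q f -> Eform mu q f = e%:E ->
  closure_val (Aset mu q) (L2sq mu) (Eform mu q) f e.
Proof.
move=> Af fe; have [mf [[M fM] _]] := Af.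
split => //; split; first exact: L2sq_lty fM.
exists (fun=> f); split => //; split; [|split] => eps eps0; exists 0%N.
- by move=> n _; rewrite /L2sq integral0_eq// => x _; rewrite subrr expr0n.
- move=> n m _ _; rewrite /Eform integral0_eq// => x _; apply: integral0_eq => y _.
  by rewrite !subrr expr0n mul0r.
- by move=> n _; rewrite fe !lte_fin; split; lra.
Qed.

Lemma unorm_le f M : (forall x, `|f x| <= M)%R -> unorm f <= M%:E.
Proof. by move=> fM; apply: ge_ereal_sup => _ [x _ <-]; rewrite lee_fin. Qed.

(** The point [o] keeps the supremum from being taken over the empty set, where it is [-oo]. *)
Lemma unorm_ge0 f : 0 <= unorm f.
Proof.
by apply: (@le_trans _ _ `|f o|%:E); [rewrite lee_fin|apply: ereal_sup_ubound; exists o].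
Qed.

Lemma weak_poincare_centered g M (s : R) : Aset mu q g -> (forall x, `|g x| <= M)%R ->
  (0 < s)%R -> exists2 c, (`|c| <= M)%R &
  L2sq mu (fun x => g x - c)%R <= (beta s * fine (Eform mu q g) + s * (4 * M ^+ 2))%:E.
Proof.
move=> Ag gM s0; have [mg _] := Ag.
have ig := bounded_integrable mu g M mg gM.
have M0 : (0 <= M)%R by exact: le_trans (gM o).
have fg := integrable_fin_num measurableT ig.
set c := fine (\int[mu]_x (g x)%:E).
have cM : (`|c| <= M)%R.
  rewrite -lee_fin -abse_EFin /c fineK//.
  apply: le_trans (le_abse_integral mu measurableT _) _; first exact/measurable_EFinP.
  apply: (@le_trans _ _ (\int[mu]_x (cst M%:E x))).
    apply: ge0_le_integral => //.
    - by apply: measurableT_comp => //; exact/measurable_EFinP.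
    - by move=> x _; rewrite lee_fin.
  by rewrite integral_cst// [X in _ * X]probability_setT mule1.
exists c => //.
have Egc : Eform mu q (fun x => g x - c)%R = (fine (Eform mu q g))%:E.
  rewrite fineK; last by rewrite ge0_fin_numE ?Eform_ge0// Eform_lty.
  by apply: eq_integral => x _; rewrite Gam_shift.
have mean0 : \int[mu]_x (g x - c)%:E = 0.
  under eq_integral do rewrite EFinB.
  have ic : mu.-integrable setT (EFin \o cst c).
    exact: finite_measure_integrable_cst.
  rewrite (integralB_EFin measurableT ig ic) /=.
  by rewrite integral_cst// [X in _ * X]probability_setT mule1 /c fineK// subee.
have := weak_poincare s _ _ s0 (closure_val_Aset _ _ (Aset_shift _ _ _ c Ag) Egc) mean0.
move=> /le_trans; apply; rewrite EFinD leeD2l// EFinM lee_pmul2l//.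
(* Centring at most doubles the uniform norm; this is the origin of 4 M^2. *)
have /unorm_le gc2M : (forall x, `|g x - c| <= 2 * M)%R.
  by move=> x; rewrite (le_trans (ler_normB _ _))//; have := gM x; lra.
apply: le_trans (lee_pmul _ _ gc2M gc2M) _; rewrite ?unorm_ge0//.
by rewrite -EFinM lee_fin; lra.
Qed.

End centered_weak_poincare.

(** With the weight [t] tending to 0 the main term keeps the factor 1, so that passing to the
    closure does not spoil the constants. *)
Lemma sqrD_le_weighted {R : realFieldType} (a b c t : R) : 0 < t ->
  (b - c) ^+ 2 <= (1 + t) * (a - c) ^+ 2 + (1 + t^-1) * (a - b) ^+ 2.
Proof.
move=> t0; set u := a - c; set w := a - b.
have -> : b - c = u - w by rewrite /u /w; ring.
have ti : t * t^-1 = 1 by rewrite mulfV// gt_eqF.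
have := mulr_ge0 (ltW t0) (sqr_ge0 (u + t^-1 * w)).
rewrite (_ : t * (u + t^-1 * w) ^+ 2 =
  t * u ^+ 2 + 2 * (t * t^-1) * (u * w) + (t * t^-1) * t^-1 * w ^+ 2); last by ring.
by rewrite ti => ?; lra.
Qed.

(** * Perturbation by V: finiteness of beta_V and the weighted deviation *)

Section perturbation.
Context {dT : measure_display} {T : measurableType dT} {R : realType}.
Context (mu : probability T R) (q : T -> T -> R) (d : T -> T -> R) (o : T).
Context (V : T -> R) (beta : R -> R).
Hypothesis md : is_metric d.
Hypothesis mdist : measurable_fun setT (fun z : T * T => d z.1 z.2).
Hypothesis mq : measurable_fun setT (fun z : T * T => q z.1 z.2).
Hypothesis q_ge0 : forall x y, 0 <= q x y.
Hypothesis lambda_fin : (lambdaq mu q d < +oo)%E.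
Hypothesis mV : measurable_fun setT V.
Hypothesis V_bounded :
  forall r : R, 0 < r -> exists M : R, forall x, d o x <= r -> `|V x| <= M.
Hypothesis expV1 : (\int[mu]_x (expR (V x))%:E = 1)%E.
Hypothesis beta_gt0 : forall r : R, 0 < r -> 0 < beta r.
Implicit Types (f g h : T -> R) (M r : R) (n k : nat).
Local Open Scope ereal_scope.

Let lambda_ge0 : 0 <= lambdaq mu q d.
Proof. exact: lambdaq_ge0. Qed.

Let lambdaE : (fine (lambdaq mu q d))%:E = lambdaq mu q d.
Proof. by rewrite fineK// ge0_fin_numE. Qed.

Let mdo : measurable_fun setT (d o).
Proof. exact: measurable_fun_dist. Qed.

Let mexpV : measurable_fun setT (fun x => expR (V x)).
Proof. exact: measurableT_comp. Qed.

Lemma integrable_expV : mu.-integrable setT (EFin \o (fun x => expR (V x))).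
Proof.
apply/integrableP; split; first exact/measurable_EFinP.
under eq_integral do rewrite /= ger0_norm ?expR_ge0//.
by rewrite expV1 ltry.
Qed.

Lemma etat_ge0 n k : 0 <= etat mu q (d o) n k.
Proof.
by apply: integral_ge0 => x _; apply: integral_ge0 => y _; rewrite lee_fin.
Qed.

Lemma gammat_ge0 k : 0 <= gammat mu q d k.
Proof.
by apply: integral_ge0 => x _; apply: integral_ge0 => y _; rewrite lee_fin.
Qed.

Lemma tail_ge0 n : 0 <= \int[mu]_(x in [set x | n%:R < d o x]%R) (expR (V x))%:E.
Proof. by apply: integral_ge0 => x _; rewrite lee_fin expR_ge0. Qed.

Lemma le_Zt n x : (1 <= n)%N -> (d o x <= n%:R)%R -> (V x <= Zt (d o) V n)%R.
Proof.
move=> n1 xn; have [M VM] := V_bounded n%:R (ltac:(by rewrite ltr0n)).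
apply: ub_le_sup; last by exists x.
by exists M => _ [y /= yn <-]; exact: le_trans (ler_norm _) (VM _ yn).
Qed.

(** Z_n - K_{n,k} is the infimum of V on the larger ball, a genuine lower bound because V is bounded
    there. *)
Lemma Kt_inf_le n k x : (d o x <= n%:R + k%:R + 1)%R ->
  (Zt (d o) V n - Kt (d o) V n k <= V x)%R.
Proof.
move=> xnk; rewrite /Kt opprB addrC subrK.
have [M VM] := V_bounded (n%:R + k%:R + 1)%R (ltac:(by rewrite ltr_wpDl)).
apply: ge_inf; last by exists x.
exists (- M)%R => _ [y /= yn <-].
by have := VM _ yn; rewrite ler_norml => /andP[].
Qed.

Lemma tail_le n m : (n <= m)%N ->
  \int[mu]_(x in [set x | m%:R < d o x]%R) (expR (V x))%:E <=
  \int[mu]_(x in [set x | n%:R < d o x]%R) (expR (V x))%:E.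
Proof.
move=> nm; apply: ge0_subset_integral; try exact: measurable_set_gt.
- by apply: measurable_funTS; exact/measurable_EFinP.
- by move=> x _; rewrite lee_fin expR_ge0.
- by move=> x /=; apply: le_lt_trans; rewrite ler_nat.
Qed.

(* An infimum equal to zero need not be approached along [n -> oo]; but for the
   finitely many [n] with a non-negligible tail [mu_V(rho > n)], the factor
   [mu(rho > n - k) >= mu(rho > n) > 0] keeps the infimised quantity away from 0. *)
Lemma betaV_lty r : (0 < r)%R ->
  ereal_inf [set ((expR (Zt (d o) V nk.1) *
      beta (r / 8 * expR (- Zt (d o) V nk.1)))%:E
    * (etat mu q (d o) nk.1 nk.2 + gammat mu q d nk.2
       + mu [set x | (nk.1%:R - nk.2%:R < d o x)%R]))%E
    | nk in [set nk : nat * nat | (1 <= nk.1)%N /\ (1 <= nk.2)%N]] = 0%E ->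
  betaV mu q d (d o) V beta r < +oo.
Proof.
move=> r0 inf0.
pose Z n := Zt (d o) V n.
pose B n := (expR (Z n) * beta (r / 8 * expR (- Z n)))%R.
pose A n := \int[mu]_(x in [set x | n%:R < d o x]%R) (expR (V x))%:E.
have B0 n : (0 < B n)%R.
  by rewrite mulr_gt0 ?expR_gt0// beta_gt0// mulr_gt0 ?expR_gt0//; lra.
have mG (a : R) : measurable [set x | (a < d o x)%R] by exact: measurable_set_gt.
have mu_fin (a : R) : mu [set x | (a < d o x)%R] \is a fin_num.
  exact: fin_num_measure.
(* The tail enters the constraint with factor 6, and 6 r / 24 = r / 4 is half of the allowed r /
   2. *)
have r24 : (0 < r / 24)%R by lra.
have [N tailN] := integral_tail_lt mu _ (d o) _ (fun x => expR_ge0 (V x))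
  integrable_expV mdo r24.
(* mu_V has a density with respect to mu, so a tail that is mu-null has no mu_V-mass. *)
have mu_tail n : (r / 24)%:E < A n ->
    (0 < B n * fine (mu [set x | (n%:R < d o x)%R]))%R.
  move=> An; apply: mulr_gt0 => //; rewrite lt_neqAle fine_ge0// andbT eq_sym.
  apply/negP => /eqP mu0.
  have {}mu0 : mu [set x | (n%:R < d o x)%R] = 0 by rewrite -(fineK (mu_fin _)) mu0.
  move: An; rewrite /A (null_set_integral _ _ mu0)//.
    by rewrite lte_fin => /lt_trans /(_ r24); rewrite ltxx.
  by apply: measurable_funTS; exact/measurable_EFinP.
have [b b0 Nb] := exists_lower_bound _ _ N mu_tail.
set l := fine (lambdaq mu q d).
have l0 : (0 <= l)%R by exact: fine_ge0.
(* Below [b] the small indices n are excluded. The other bound gives the remaining r / 4, since 2 (4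
   h + g + 4 l p) <= 8 (1 + l) (h + g + p). *)
pose c := Num.min b (r / (32 * (1 + l)))%R.
have c0 : (0 < c)%R by rewrite lt_min b0 divr_gt0// mulr_gt0//; lra.
have : 0 < c%:E by rewrite lte_fin.
rewrite -inf0 => /ereal_inf_lt[_ [[n k] /= [n1 k1] <-]].
move: (etat_ge0 n k) (gammat_ge0 k).
have p0 : 0 <= mu [set x | (n%:R - k%:R < d o x)%R] by [].
move=> h0 g0 small.
have S0 : 0 <= etat mu q (d o) n k + gammat mu q d k +
  mu [set x | (n%:R - k%:R < d o x)%R] by enneg.
have [S S1 SS] := ge0_le_EFin _ _ S0 (pmul_le_EFin _ _ _ (B0 n) (ltW small)).
have Sle : etat mu q (d o) n k + gammat mu q d k +
  mu [set x | (n%:R - k%:R < d o x)%R] <= S%:E by rewrite SS.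
have hg := ge0_addl_le _ _ _ p0 Sle.
have [h h1 hh] := ge0_le_EFin _ _ h0 (ge0_addl_le _ _ _ g0 hg).
have [g g1 gg] := ge0_le_EFin _ _ g0 (ge0_addr_le _ _ _ h0 hg).
have [p p1 pp] := ge0_le_EFin _ _ p0 (ge0_addr_le _ _ _ (adde_ge0 h0 g0) Sle).
move: small; rewrite hh gg pp -!EFinM lte_fin -/(Z n) -/(B n) lt_min => /andP[sb sl].
have Bh : (0 <= B n * h)%R by rewrite mulr_ge0// ltW.
have Bg : (0 <= B n * g)%R by rewrite mulr_ge0// ltW.
have Bp : (0 <= B n * p)%R by rewrite mulr_ge0// ltW.
have tail24 : A n <= (r / 24)%:E.
  rewrite leNgt; apply/negP => An.
  have [nN|Nn] := ltnP n N.
    have := Nb n nN An; apply/negP; rewrite -ltNge; apply: le_lt_trans sb.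
    rewrite !mulrDr; apply: le_trans (_ : B n * p <= _)%R; last lra.
    apply: ler_wpM2l; first exact: ltW.
    rewrite -lee_fin -pp fineK// le_measure ?inE//.
    move=> x /=; apply: le_lt_trans.
    by rewrite lerBlDr lerDl.
  have := lt_le_trans An (tail_le _ _ Nn).
  by move=> /lt_trans /(_ tailN); rewrite ltxx.
have [a a0 aa] := ge0_le_EFin _ _ (tail_ge0 n) tail24.
apply: le_lt_trans (ltry (2 * beta (r / 8 * expR (- Z n)) * expR (Kt (d o) V n k))%R).
apply: ereal_inf_lbound; exists (n, k) => //=; split => //; split => //.
move: tail24; rewrite /A aa lee_fin => tail24.
rewrite hh gg pp -lambdaE -/l -!EFinM lee_fin -/(Z n).
rewrite -(mulrA 2%R) -/(B n).
have l1 : (0 < 32 * (1 + l))%R by rewrite mulr_gt0//; lra.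
move: sl; rewrite ltr_pdivlMr// => sl.
have := mulr_ge0 l0 Bh; have := mulr_ge0 l0 Bg; have := mulr_ge0 l0 Bp.
have -> : (2 * B n * (4 * h + g + 4 * l * p) =
  8 * (B n * h) + 2 * (B n * g) + 8 * (l * (B n * p)))%R by ring.
move: sl; rewrite (_ : B n * (h + g + p) * (32 * (1 + l)) =
  32 * (B n * h + B n * g + B n * p + l * (B n * h) + l * (B n * g) +
  l * (B n * p)))%R; last by ring.
lra.
Qed.

(** On rho <= n the two functions agree and e^V <= e^Z; outside, |f - c| <= 2 M. *)
Lemma weighted_deviation_le f g M c Z n : measurable_fun setT f ->
  measurable_fun setT g -> (forall x, `|f x| <= M)%R -> (`|c| <= M)%R ->
  (forall x, d o x <= n%:R -> g x = f x /\ V x <= Z)%R ->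
  \int[mu]_x (expR (V x) * (f x - c) ^+ 2)%:E <=
  (expR Z)%:E * L2sq mu (fun x => g x - c)%R +
  (4 * M ^+ 2)%:E * \int[mu]_(x in [set x | n%:R < d o x]%R) (expR (V x))%:E.
Proof.
move=> mf mg fM cM gf.
have m1 h : measurable_fun setT h -> measurable_fun setT (fun x => (h x - c) ^+ 2)%R.
  by move=> mh; apply: measurable_funX; exact: measurable_funB.
have m2 : measurable_fun setT
    (fun x => \1_[set x | n%:R < d o x]%R x * expR (V x))%R.
  by apply: measurable_funM => //; apply: measurable_indic; exact: measurable_set_gt.
have M4 : (0 <= 4 * M ^+ 2)%R by nneg.
rewrite (integral_mkcond_EFin _ [set x | (n%:R < d o x)%R]) /L2sq.
rewrite -!ge0_integralZ_EFin ?expR_ge0//; try exact: m1; try by move=> x; nneg.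
rewrite -ge0_integralD_EFin; last 4 first.
- by apply: measurable_funM => //; exact: m1.
- exact: measurable_funM.
- by move=> x; nneg.
- by move=> x; apply: mulr_ge0 => //; nneg.
apply: ge0_le_integral_EFin.
- by apply: measurable_funM => //; exact: m1.
- by apply: measurable_funD; apply: measurable_funM => //; exact: m1.
- by move=> x; nneg.
move=> x; have [xn|nx] := leP (d o x) n%:R.
  have [-> VZ] := gf x xn.
  apply: (@le_trans _ _ (expR Z * (f x - c) ^+ 2)%R).
    by rewrite ler_wpM2r ?sqr_ge0// ler_expR.
  by rewrite lerDl mulr_ge0//; nneg.
rewrite (indic_in [set x | n%:R < d o x]%R)// mul1r.
apply: (@le_trans _ _ (4 * M ^+ 2 * expR (V x))%R); last by rewrite lerDr; nneg.
rewrite mulrC ler_wpM2r ?expR_ge0// (_ : 4 * M ^+ 2 = (2 * M) ^+ 2)%R; last by ring.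
rewrite -(real_normK (num_real (f x - c))) lerXn2r ?nnegrE//.
  by have := normr_ge0 c; lra.
by rewrite (le_trans (ler_normB _ _))//; have := fM x; lra.
Qed.

(** * The weak Poincare inequality for mu_V, on A and then on the closure *)

Section weak_poincare.
Hypothesis weak_poincare : forall (r : R) (f : T -> R) (e : R), (0 < r)%R ->
  closure_val (Aset mu q) (L2sq mu) (Eform mu q) f e ->
  (\int[mu]_x (f x)%:E = 0)%E ->
  (L2sq mu f <= (beta r * e)%:E + r%:E * (unorm f * unorm f))%E.

(* With [s = (r/8) e^-Z], the oscillation term [s ||g - mu(g)||^2 <= 4 s M^2] of
   the weak Poincare inequality contributes exactly [(r/2) M^2]. *)
Lemma quadratic_deviation_le f M r n k (Z K E : R) : (0 < r)%R ->
  Aset mu q f -> (forall x, `|f x| <= M)%R -> EformV mu q V f <= E%:E ->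
  (forall x, d o x <= n%:R -> V x <= Z)%R ->
  (forall x, d o x <= n%:R + k%:R + 1 -> Z - K <= V x)%R ->
  6%:E * (\int[mu]_(x in [set x | n%:R < d o x]%R) (expR (V x))%:E)
       + (2 * expR Z * beta (r / 8 * expR (- Z)))%R%:E
         * (4%:E * etat mu q (d o) n k + gammat mu q d k
            + 4%:E * lambdaq mu q d * mu [set x | n%:R - k%:R < d o x]%R)
       <= (r / 2)%R%:E ->
  exists2 c, (`|c| <= M)%R & \int[mu]_x (expR (V x) * (f x - c) ^+ 2)%:E <=
    (2 * beta (r / 8 * expR (- Z)) * expR K * E + r * M ^+ 2)%:E.
Proof.
move=> r0 Af fM fE VZ ZKV; have [mf _] := Af.
set s := (r / 8 * expR (- Z))%R.
have s0 : (0 < s)%R by rewrite mulr_gt0 ?expR_gt0//; lra.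
have b0 := beta_gt0 s s0.
have ZZ := expR_gt0 Z.
have B0 : (0 < 2 * expR Z * beta s)%R by rewrite mulr_gt0// mulr_gt0.
have C0 := expR_ge0 (K - Z).
(* As Z - K is a lower bound of V on this ball, e^(K - Z) plays the part of e^(-inf V). *)
have CV x : (d o x <= n%:R + k%:R + 1)%R -> (1 <= expR (K - Z) * expR (V x))%R.
  move=> /ZKV ZK; rewrite -expRD -[leLHS]expR0 ler_expR; lra.
have energy :=
  cutoff_energy_le mu q d o md mq q_ge0 mdist f V M _ n k C0 mf mV fM CV.
have ml : measurable_fun setT (fun x => cutoff n%:R (d o x)).
  by apply: measurable_clamp; exact: measurable_funB.
pose g x := (f x * cutoff n%:R (d o x))%R.
have Ag : Aset mu q g by exact: Aset_cutoff.
have gM x : (`|g x| <= M)%R.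
  rewrite normrM (ger0_norm (cutoff_ge0 _ _)).
  by rewrite (le_trans (ler_piMr _ (cutoff_le1 _ _))).
have [c cM gc] :=
  weak_poincare_centered mu q o beta mq q_ge0 weak_poincare g M s Ag gM s0.
have gf x : (d o x <= n%:R)%R -> g x = f x /\ (V x <= Z)%R.
  by move=> xn; split; [rewrite /g cutoff_eq1 ?mulr1|exact: VZ].
have dev := weighted_deviation_le f g M c Z n mf (proj1 Ag) fM cM gf.
have Eg : (fine (Eform mu q g))%:E = Eform mu q g.
  by rewrite fineK// ge0_fin_numE ?Eform_ge0// Eform_lty.
move=> adm; exists c => //; apply: le_trans dev _; move: adm energy gc.
rewrite -/g -Eg -lambdaE -muleA -/s.
move: (etat_ge0 n k) (gammat_ge0 k) (tail_ge0 n).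
have p0 : 0 <= mu [set x | (n%:R - k%:R < d o x)%R] by [].
have [e0 l0] : (0 <= fine (Eform mu q g) /\ 0 <= fine (lambdaq mu q d))%R.
  by split; apply: fine_ge0 => //; exact: Eform_ge0.
have pfin : mu [set x | (n%:R - k%:R < d o x)%R] \is a fin_num.
  apply: fin_num_measure.
  exact: measurable_set_gt.
move: p0 fE (EformV_ge0 mu q q_ge0 V f); rewrite -(fineK pfin).
have: 0 <= L2sq mu (fun x => g x - c)%R.
  by apply: ge0_integral_EFin => x; nneg.
set h := etat _ _ _ _ _; set gm := gammat _ _ _ _; set a := integral _ _ _.
set p := fine (mu _); set l := fine (lambdaq _ _ _); set e := fine (Eform _ _ _).
set b := beta s; set W := EformV _ _ _ _; set L := L2sq _ _.
move=> L0 p0 WE W0 h0 g0 a0 adm energy Lle.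
have [W' W'0 WW] := ge0_le_EFin _ _ W0 WE.
have [L' L'0 LL] := ge0_le_EFin _ _ L0 Lle.
have S0 : 0 <= 4%:E * h + gm + 4%:E * (l%:E * p%:E).
  enneg.
(* The tail, eta and gamma are extended reals. The constraint bounds their sum with positive
   coefficients, hence each of them is finite and real arithmetic can conclude. *)
have [a' a'0 aa] : exists2 a' : R, (0 <= a')%R & a = a'%:E.
  apply: ge0_le_EFin a0 (pmul_le_EFin 6 _ _ (ltr0n _ 6) _).
  by apply: ge0_addl_le adm; apply: mule_ge0 => //; rewrite lee_fin ltW.
have [S' S'0 SS] : exists2 S' : R, (0 <= S')%R & 4%:E * h + gm + 4%:E * (l%:E * p%:E) = S'%:E.
  apply: ge0_le_EFin S0 (pmul_le_EFin _ _ _ B0 _).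
  by apply: ge0_addr_le adm; enneg.
have Sle : 4%:E * h + gm + 4%:E * (l%:E * p%:E) <= S'%:E by rewrite SS.
have lp0 : 0 <= 4%:E * (l%:E * p%:E) by enneg.
have hg := ge0_addl_le _ _ _ lp0 Sle.
have [h' h'0 hh] : exists2 h' : R, (0 <= h')%R & h = h'%:E.
  apply: ge0_le_EFin h0 (pmul_le_EFin 4 _ _ (ltr0n _ 4) _).
  exact: ge0_addl_le hg.
have [g' g'0 gg] : exists2 g' : R, (0 <= g')%R & gm = g'%:E.
  apply: ge0_le_EFin g0 (ge0_addr_le _ _ _ _ hg).
  enneg.
move: adm energy Lle WE; rewrite LL WW aa hh gg.
rewrite -!EFinM !lee_fin => adm energy /= Lle WE.
have p0' : (0 <= p)%R by rewrite -lee_fin.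
have sZ : (expR Z * s = r / 8)%R.
  by rewrite /s mulrCA -expRD subrr expR0 mulr1.
have KE : expR K = (expR Z * expR (K - Z))%R by rewrite -expRD addrC subrK.
rewrite KE; set C := expR (K - Z) in energy C0 *; set z := expR Z in ZZ B0 adm sZ *.
have lp : (0 <= l * p)%R by rewrite mulr_ge0.
have zb : (0 < z * b)%R by rewrite mulr_gt0.
have energy' : (e <= M ^+ 2 * (h' + 2 * g' + 2 * (l * p)) + 2 * C * E)%R.
  by have := ler_wpM2l (ltac:(nneg) : (0 <= 2 * C)%R) WE; lra.
have zL : (z * L' <= z * b * e + r / 2 * M ^+ 2)%R.
  have -> : (z * b * e + r / 2 * M ^+ 2 = z * (b * e + s * (4 * M ^+ 2)))%R.
    by rewrite (_ : (r = 8 * (z * s))%R); [field|rewrite sZ; field].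
  exact: ler_wpM2l (ltW ZZ) _ _ Lle.
have zbe := ler_wpM2l (ltW zb) energy'.
(* Termwise comparison with the constraint, whose coefficients are 8, 2 and 8 on the three jump
   terms and 6 on the tail; for gamma the two coefficients coincide. *)
have adm' : (z * b * (h' + 2 * g' + 2 * (l * p)) + 4 * a' <= r / 2)%R.
  have := mulr_ge0 (ltW zb) h'0; have := mulr_ge0 (ltW zb) lp; move: adm.
  set t := (z * b)%R; rewrite (_ : 2 * z * b = 2 * t)%R; [|by rewrite /t; ring].
  move: (l * p)%R => u; lra.
have := ler_wpM2l (sqr_ge0 M) adm'; move: zbe; rewrite !mulrDr; lra.
Qed.

(** The constant [c] changes with the approximant, but f itself has mu_V-mean zero, so its deviation
    from any [c] dominates its square norm. That deviation is compared with the one of the truncated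
    approximant. *)
Lemma L2sqV_le_closure f M r n k (v e : R) : (0 < r)%R -> (1 <= n)%N ->
  closure_val (Aset mu q) (L2sqV mu V) (EformV mu q V) f e ->
  (forall x, `|f x| <= M)%R -> \int[mu]_x (expR (V x) * f x)%:E = 0 ->
  6%:E * (\int[mu]_(x in [set x | n%:R < d o x]%R) (expR (V x))%:E)
       + (2 * expR (Zt (d o) V n) * beta (r / 8 * expR (- Zt (d o) V n)))%R%:E
         * (4%:E * etat mu q (d o) n k + gammat mu q d k
            + 4%:E * lambdaq mu q d * mu [set x | n%:R - k%:R < d o x]%R)
       <= (r / 2)%R%:E ->
  L2sqV mu V f <= (2 * beta (r / 8 * expR (- Zt (d o) V n)) *
    expR (Kt (d o) V n k) * e + r * M ^+ 2)%:E.
Proof.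
move=> r0 n1 [mf [_ [fn [Afn [fnf [_ fne]]]]]] fM f0 adm.
have M0 : (0 <= M)%R by exact: le_trans (fM o).
set v' := (2 * beta _ * _)%R.
have v0 : (0 <= v')%R.
  by rewrite !mulr_ge0 ?expR_ge0// ltW// beta_gt0// mulr_gt0 ?expR_gt0//; lra.
have approx (t eps : R) : (0 < t)%R -> (0 < eps)%R -> L2sqV mu V f <=
    ((1 + t) * (v' * (e + eps) + r * M ^+ 2) + (1 + t^-1) * eps)%:E.
  move=> t0 eps0.
  have [N1 fN1] := fnf eps eps0; have [N2 eN2] := fne eps eps0.
  have fN := fN1 _ (leq_maxl N1 N2); have [_ eN] := eN2 _ (leq_maxr N1 N2).
  move: fN eN; set u := fn _ => fN eN.
  have Au : Aset mu q u by exact: Afn.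
  have mu_ : measurable_fun setT u by case: Au.
  pose h x := clamp (- M) M (u x).
  have hM x : (`|h x| <= M)%R by exact: norm_clamp.
  have mh : measurable_fun setT h by exact: measurable_clamp.
  have Ah : Aset mu q h by exact: Aset_clamp.
  have hE : EformV mu q V h <= (e + eps)%:E.
    apply: le_trans (ltW eN); apply: le_EformV => // x.
    exact: Gam_clamp.
  have [c cM hc] := quadratic_deviation_le h M r n k _ _ _ r0 Ah hM hE
    (fun x => le_Zt n x n1) (fun x => Kt_inf_le n k x) adm.
  have mw g : measurable_fun setT g ->
      measurable_fun setT (fun x => expR (V x) * g x ^+ 2)%R.
    by move=> mg; apply: measurable_funM => //; exact: measurable_funX.
  have mhc : measurable_fun setT (fun x => h x - c)%R by exact: measurable_funB.
  have muf : measurable_fun setT (fun x => u x - f x)%R by exact: measurable_funB.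
  have mfc : measurable_fun setT (fun x => f x - c)%R by exact: measurable_funB.
  apply: le_trans (le_sqr_deviation mu _ f M c (fun x => expR_ge0 _)
    integrable_expV mf fM f0) _.
  have ti : (0 < t^-1)%R by rewrite invr_gt0.
  apply: (@le_trans _ _
    ((1 + t)%:E * \int[mu]_x (expR (V x) * (h x - c) ^+ 2)%:E +
     (1 + t^-1)%:E * L2sqV mu V (fun x => u x - f x)%R)); last first.
    rewrite [leRHS]EFinD; apply: leeD.
      by rewrite [leRHS]EFinM lee_wpmul2l// lee_fin; lra.
    by rewrite [leRHS]EFinM lee_wpmul2l ?(ltW fN)// lee_fin; lra.
  have t1 : (0 <= 1 + t)%R by lra.
  have ti1 : (0 <= 1 + t^-1)%R by lra.
  rewrite /L2sqV -!ge0_integralZ_EFin//; try exact: mw; try by move=> x; nneg.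
  rewrite -ge0_integralD_EFin; last 4 first.
  - by apply: measurable_funM => //; exact: mw.
  - by apply: measurable_funM => //; exact: mw.
  - by move=> x; apply: mulr_ge0 => //; nneg.
  - by move=> x; apply: mulr_ge0 => //; nneg.
  apply: ge0_le_integral_EFin.
  - exact: mw.
  - by apply: measurable_funD; apply: measurable_funM => //; exact: mw.
  - by move=> x; nneg.
  move=> x; rewrite !(mulrCA _ (expR (V x))) -mulrDr ler_wpM2l ?expR_ge0//.
  (* Truncation at M fixes f and is 1-Lipschitz, so it brings the approximant no farther from f. *)
  have huf : ((h x - f x) ^+ 2 <= (u x - f x) ^+ 2)%R.
    rewrite -(real_normK (num_real (h x - f x))).
    rewrite -(real_normK (num_real (u x - f x))) lerXn2r ?nnegrE//.
    have [fm fp] : (- M <= f x /\ f x <= M)%R.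
      by apply/andP; rewrite -ler_norml.
    by rewrite -{1}(clamp_id (- M) M (f x) fm fp) clamp_lip.
  apply: (@le_trans _ _ ((1 + t) * (h x - c) ^+ 2 + (1 + t^-1) * (h x - f x) ^+ 2)%R).
    exact: sqrD_le_weighted.
  by rewrite lerD2l ler_wpM2l.
have L0 : 0 <= L2sqV mu V f by apply: ge0_integral_EFin => x; nneg.
(* A first instance, with arbitrary parameters, only shows that the norm is finite. *)
have [x x0 Lx] := ge0_le_EFin _ _ L0 (approx 1 1 ltr01 ltr01)%R.
rewrite Lx lee_fin; set w := (v' * e + r * M ^+ 2)%R.
have w0 : (0 <= `|w|)%R by [].
(* The limit in [eps] is taken at fixed [t], because its coefficient contains 1 / t; [t] goes to 0
   afterwards. *)
apply: (ler_addgt0M _ _ `|w| w0) => t t0.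
have K0 : (0 <= (1 + t) * v' + (1 + t^-1))%R.
  have ti : (0 < t^-1)%R by rewrite invr_gt0.
  by apply: addr_ge0; [apply: mulr_ge0 => //|]; lra.
apply: (ler_addgt0M _ _ _ K0) => eps eps0.
have := approx t eps t0 eps0; rewrite Lx lee_fin => /le_trans; apply.
have := ler_wpM2r (ltW t0) (ler_norm w).
rewrite (_ : (1 + t) * (v' * (e + eps) + r * M ^+ 2) + (1 + t^-1) * eps =
  w + w * t + ((1 + t) * v' + (1 + t^-1)) * eps)%R; last by rewrite /w; ring.
lra.
Qed.

Lemma betaV_ge0 r : (0 < r)%R -> 0 <= betaV mu q d (d o) V beta r.
Proof.
move=> r0; apply: le_ereal_inf_tmp => _ [nk _ <-]; rewrite lee_fin.
by rewrite !mulr_ge0 ?expR_ge0// ltW// beta_gt0// mulr_gt0 ?expR_gt0//; lra.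
Qed.

Lemma closure_val_ge0 f (e : R) :
  closure_val (Aset mu q) (L2sqV mu V) (EformV mu q V) f e -> (0 <= e)%R.
Proof.
move=> [_ [_ [fn [_ [_ [_ fne]]]]]]; apply/ler_addgt0Pr => eps eps0.
have [N /(_ N (leqnn N))[_ eN]] := fne eps eps0.
by rewrite -lee_fin; apply: le_trans (ltW eN); exact: EformV_ge0.
Qed.

Lemma weak_poincare_perturbed r f (e : R) : (0 < r)%R ->
  betaV mu q d (d o) V beta r < +oo ->
  closure_val (Aset mu q) (L2sqV mu V) (EformV mu q V) f e ->
  \int[mu]_x (expR (V x) * f x)%:E = 0 ->
  L2sqV mu V f <= betaV mu q d (d o) V beta r * e%:E + r%:E * (unorm f * unorm f).
Proof.
move=> r0 bfin cf f0.
have e0 := closure_val_ge0 _ _ cf; have b0 := betaV_ge0 r r0.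
have U0 := unorm_ge0 o f.
have : forall x, `|f x|%:E <= unorm f by move=> x; apply: ereal_sup_ubound; exists x.
(* For unbounded f the right-hand side is [+oo]: r > 0, and the energy term is nonnegative, so it
   cannot be [-oo]. *)
case: (unorm f) U0 => // [M|] M0 fM; last first.
  rewrite gt0_mulye// gt0_muley ?lte_fin// addey ?leey//.
  by rewrite gt_eqF// (lt_le_trans (ltNyr 0))// mule_ge0.
have bf : betaV mu q d (d o) V beta r \is a fin_num by rewrite ge0_fin_numE.
(* The infimum defining beta_V need not be attained: an admissible pair within [eps] is used, and
   the error [eps * e] vanishes in the limit. *)
have bound (eps : R) : (0 < eps)%R ->
    L2sqV mu V f <= ((fine (betaV mu q d (d o) V beta r) + eps) * e + r * M ^+ 2)%:E.
  move=> eps0; have [_ [[n k] /= [n1 [_ adm]] <-]] := lb_ereal_inf_adherent eps0 bf.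
  rewrite -/(betaV mu q d (d o) V beta r) -(fineK bf) lte_fin => vb.
  apply: le_trans (L2sqV_le_closure f M r n k _ e r0 n1 cf _ f0 adm) _ => //.
  by rewrite lee_fin lerD2r ler_wpM2r// ltW.
have L0 : 0 <= L2sqV mu V f by apply: ge0_integral_EFin => x; nneg.
have [x x0 Lx] := ge0_le_EFin _ _ L0 (bound 1 ltr01)%R.
rewrite -(fineK bf) Lx -!EFinM -EFinD lee_fin.
apply: (ler_addgt0M _ _ e e0) => eps eps0.
have := bound eps eps0; rewrite Lx lee_fin => /le_trans; apply.
by rewrite expr2 mulrDl; lra.
Qed.

End weak_poincare.
End perturbation.

Theorem theorem3p1 (dT : measure_display) (T : measurableType dT) (R : realType)
  (d : T -> T -> R) (mu : probability T R) (q : T -> T -> R) (o : T)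
  (V : T -> R) (beta : R -> R) :
  is_polish d -> is_borel d ->
  measurable_fun setT (fun z : T * T => q z.1 z.2) ->
  (forall x y, 0 <= q x y) -> (forall x, q x x = 0) ->
  (lambdaq mu q d < +oo)%E ->
  (* A is dense in L^2(mu) *)
  (forall f : T -> R, measurable_fun setT f -> (L2sq mu f < +oo)%E ->
     forall eps : R, 0 < eps -> exists2 g, Aset mu q g &
       (L2sq mu (fun x => (f x - g x)%R) < eps%:E)%E) ->
  (* V *)
  measurable_fun setT V ->
  (forall r : R, 0 < r -> exists M : R, forall x, d o x <= r -> `|V x| <= M) ->
  (\int[mu]_x (expR (V x))%:E = 1)%E ->
  (* beta decreasing, positive *)
  (forall r s : R, 0 < r -> r <= s -> beta s <= beta r) ->
  (forall r : R, 0 < r -> 0 < beta r) ->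
  (* weak Poincare inequality for (E, D(E)) *)
  (forall (r : R) (f : T -> R) (e : R), 0 < r ->
     closure_val (Aset mu q) (L2sq mu) (Eform mu q) f e ->
     (\int[mu]_x (f x)%:E = 0)%E ->
     (L2sq mu f <= (beta r * e)%:E + r%:E * (unorm f * unorm f))%E) ->
  (* condition *)
  (forall eps : R, 0 < eps ->
     ereal_inf [set ((expR (Zt (d o) V nk.1) * beta (eps * expR (- Zt (d o) V nk.1)))%:E
         * (etat mu q (d o) nk.1 nk.2 + gammat mu q d nk.2
            + mu [set x | (nk.1%:R - nk.2%:R < d o x)%R]))%E
       | nk in [set nk : nat * nat | (1 <= nk.1)%N /\ (1 <= nk.2)%N]] = 0%E) ->
  (forall r : R, 0 < r -> (betaV mu q d (d o) V beta r < +oo)%E) /\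
  (forall (r : R) (f : T -> R) (e : R), 0 < r ->
     closure_val (Aset mu q) (L2sqV mu V) (EformV mu q V) f e ->
     (\int[mu]_x (expR (V x) * f x)%:E = 0)%E ->
     (L2sqV mu V f <= betaV mu q d (d o) V beta r * e%:E + r%:E * (unorm f * unorm f))%E).
Proof.
move=> polish borel mq q0 _ lfin _ mV Vb expV1 _ beta0 wp inf0.
have md : is_metric d by case: polish.
have mdist := measurable_fun_metric d polish borel.
have bfin r : 0 < r -> (betaV mu q d (d o) V beta r < +oo)%E.
  move=> r0; apply: betaV_lty => //; apply: inf0; lra.
split=> // r f e r0 cf f0.
by apply: weak_poincare_perturbed => //; exact: bfin.
Qed.
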